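(* For $t\in[1,\infty)$ define $$F(t)=\begin{bmatrix}\frac1{t^2}&\frac1{t^2}&0&0&\sqrt{\frac{t^4-1}{t^4}}&-\sqrt{\frac{t^4-1}{t^4}}\\[2pt]0&0&\sqrt{\frac{t^4-1}{t^4}}&-\sqrt{\frac{t^4-1}{t^4}}&\frac1{t^2}&\frac1{t^2}\\[2pt]\sqrt{\frac{t^4-1}{t^4}}&-\sqrt{\frac{t^4-1}{t^4}}&\frac1{t^2}&\frac1{t^2}&0&0\end{bmatrix}\in\mathbb R^{3\times 6}.$$ Then for every $t\in[1,\infty)$: (i) the rows of $F(t)$ are pairwise orthogonal; (ii) every row of $F(t)$ has squared norm $2$; (iii) every column of $F(t)$ has norm $1$; (iv) the frame angle set of the columns of $F(t)$ is $\Theta(t)=\left\{\left|\frac{2-t^4}{t^4}\right|,\frac{\sqrt{t^4-1}}{t^4}\right\}$. Consequently, $F(t)$, $t\in[1,\infty)$, corresponds to a smooth curve of frames passing through the space of real $(6,3)$-frames, every point of which is a biangular tight frame (allowing the two frame angles to coincide), and the corresponding frame angles vary smoothly with the parameter $t$. Moreover, the curve passes through an equiangular tight frame: for $t=\sqrt[4]{\frac{5+\sqrt5}{2}}$ one has $\Theta(t)=\{\frac1{\sqrt5}\}$, so that $F(t)$ is an equiangular tight frame.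
   Context: An $(n,m)$-frame for $\mathbb R^m$ is a family $\{f_j\}_{j=1}^n$ of $n$ unit vectors spanning $\mathbb R^m$ that is tight, i.e. its synthesis matrix $F=[f_1\,\cdots\,f_n]$ satisfies $FF^*=aI_m$ for some $a>0$. A frame is identified with its synthesis matrix. Its frame angle set is $\{|\langle f_j,f_{j'}\rangle| : j\neq j'\}$; it is equiangular if this set has one element and biangular if it has two. Biangular tight frames are here understood to include equiangular tight frames (as the case where the two angles agree).
   Formalization: Smoothness in t is false at t=1 (square roots) and, for the first angle, at t^4=2 (absolute value): it is stated for t>1, for the first angle for t>=1 with t^4≠2, with continuity on [1,∞) and a smooth regular reparametrization through t=1 (first angle up to absolute value). *)

(* Defs.v *)
From HB Require Import structures.
From mathcomp Require Import all_boot all_order all_algebra.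
From mathcomp Require Import all_classical all_reals all_analysis.

Set Implicit Arguments.
Unset Strict Implicit.
Unset Printing Implicit Defensive.

Import Order.TTheory GRing.Theory Num.Theory.
Import numFieldNormedType.Exports.

Local Open Scope classical_set_scope.
Local Open Scope ring_scope.

(* The norm `|u| that the library puts on matrices is the sup norm, hence the
   separate Euclidean norm. *)
Definition dot (R : realType) (k : nat) (u v : 'rV[R]_k) : R :=
  \sum_(i < k) u 0 i * v 0 i.

Definition enorm (R : realType) (k : nat) (u : 'rV[R]_k) : R :=
  Num.sqrt (dot u u).

(* The j-th frame vector, transposed so that dot and enorm apply. *)
Definition fvec (R : realType) (m n : nat) (F : 'M[R]_(m, n)) (j : 'I_n) :
  'rV[R]_m := (col j F)^T.

(* Real (n,m)-frames, identified with their synthesis matrices; rank m says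
   that the columns span R^m. *)
Definition real_frames (R : realType) (n m : nat) : set 'M[R]_(m, n) :=
  [set F | [/\ forall j, enorm (fvec F j) = 1,
               \rank F = m &
               exists2 a : R, 0 < a & F *m F^T = a%:M]].
Arguments real_frames : clear implicits.

Definition frame_angles (R : realType) (m n : nat) (F : 'M[R]_(m, n)) : set R :=
  [set x | exists j j' : 'I_n,
             j != j' /\ x = `|dot (fvec F j) (fvec F j')|].

Definition equiangular (R : realType) (m n : nat) (F : 'M[R]_(m, n)) : Prop :=
  exists a : R, frame_angles F = [set a].

(* The two angles may coincide, so equiangular frames are included. *)
Definition biangular (R : realType) (m n : nat) (F : 'M[R]_(m, n)) : Prop :=
  exists a b : R, frame_angles F = [set a; b].

(* C^oo at x.  Since derive1n is a total operator (a junk value where the limit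
   does not exist), differentiability is required on a neighborhood of x. *)
Definition smooth_at (R : realType) (V : normedModType R) (f : R -> V) (x : R) :
  Prop := forall n : nat, \forall y \near x, derivable (derive1n n f) y 1.

Definition smooth_on (R : realType) (V : normedModType R) (A : set R)
  (f : R -> V) : Prop := forall x, A x -> smooth_at f x.

Definition curve (R : realType) (t : R) : 'M[R]_(3, 6) :=
  let a := 1 / t ^+ 2 in
  let b := Num.sqrt ((t ^+ 4 - 1) / t ^+ 4) in
  \matrix_(i < 3, j < 6)
    nth 0 (nth [::] [:: [:: a;  a;   0;  0;   b;  - b];
                        [:: 0;  0;   b;  - b; a;  a];
                        [:: b;  - b; a;  a;   0;  0]] i) j.

Definition signed_angle1 (R : realType) (t : R) : R := (2 - t ^+ 4) / t ^+ 4.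

Definition angle1 (R : realType) (t : R) : R := `|signed_angle1 t|.

Definition angle2 (R : realType) (t : R) : R := Num.sqrt (t ^+ 4 - 1) / t ^+ 4.

Definition Theta (R : realType) (t : R) : set R := [set angle1 t; angle2 t].

(* Main.v *)
Require Import Defs.
From HB Require Import structures.
From mathcomp Require Import all_boot all_order all_algebra.
From mathcomp Require Import all_classical all_reals all_analysis.
From mathcomp Require Import ring lra.

Set Implicit Arguments.
Unset Strict Implicit.
Unset Printing Implicit Defensive.

Import Order.TTheory GRing.Theory Num.Theory.
Import numFieldNormedType.Exports.

Local Open Scope classical_set_scope.
Local Open Scope ring_scope.

(** Write x = 1/t^2 and y = sqrt(1 - 1/t^4), so that x^2 + y^2 = 1.  The matrix
is linear in (x, y), and its columns are, up to cyclic permutations of the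
coordinates, the three pairs (x, 0, y), (x, 0, -y).  Hence all the metric facts
are identities in x and y modulo x^2 + y^2 = 1: the columns have norm 1, the
rows are orthogonal of squared norm 2(x^2 + y^2) = 2, two columns of the same
pair have inner product x^2 - y^2, and columns of different pairs overlap in
exactly one coordinate, with inner product xy up to sign.  This
is [pencil_real_frame] and [pencil_angles].  Substituting t gives
x^2 - y^2 = (2 - t^4)/t^4 and xy = sqrt(t^4 - 1)/t^4.

Smoothness is obtained without computing higher derivatives: if each function
of a set G has, on an open set U, a derivative in the algebra generated by G,
then this algebra is stable under derivation on U, so that its elements, and
combinations of constant vectors with coefficients in it, are smooth on U
([combination_smooth_on]).  It is applied to 1/t on t > 0, to t, 1/t and
1/sqrt(t^4 - 1) on t > 1, and to sin and cos on the whole line.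

At t = 1 the square root is singular, but (x, y) runs on the unit circle, so the
curve is the smooth regular curve (cos s, sin s) in the parameter
s = atan(sqrt(t^4 - 1)), a strictly increasing continuous function of t.  In
this parameter the angles are |cos^2 s - sin^2 s| and cos s * sin s.

The angles coincide when t^4 = (5 + sqrt 5)/2: with s = sqrt 5 one has
t^4 - 1 = ((1 + s)/2)^2 and t^4 - 2 = (1 + s)/2, while t^4 = s(1 + s)/2. *)

(** * Smoothness from an algebra of functions stable under derivation *)

Inductive generated {R : realType} (G : set (R -> R)) : (R -> R) -> Prop :=
| gen_cst (c : R) : generated G (fun=> c)
| gen_base f : G f -> generated G f
| gen_add f g : generated G f -> generated G g ->
    generated G (fun t => f t + g t)
| gen_mul f g : generated G f -> generated G g ->
    generated G (fun t => f t * g t).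

(** Functions [t |-> \sum_i f_i t *: v_i] with coefficients in the algebra
generated by [G] and constant vectors; they make vector-valued curves accessible
to the same argument as scalar functions. *)
Inductive combination {R : realType} {V : normedModType R} (G : set (R -> R)) :
  (R -> V) -> Prop :=
| comb_scale f v : generated G f -> combination G (fun t => f t *: v)
| comb_add F1 F2 : combination G F1 -> combination G F2 ->
    combination G (fun t => F1 t + F2 t).

Definition closed_under_derivation {R : realType} (U : set R)
    (G : set (R -> R)) :=
  forall f, G f -> exists2 df, generated G df &
    forall x, U x -> is_derive x 1 f (df x).

Section Smoothness.
Context {R : realType}.
Implicit Types (U : set R) (G : set (R -> R)).

Lemma gen_opp G f : generated G f -> generated G (fun t => - f t).
Proof.
move=> Gf; have -> : (fun t => - f t) = (fun t => -1 * f t).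
  by apply/funext => t; rewrite mulN1r.
by apply: gen_mul => //; apply: gen_cst.
Qed.

Lemma gen_exp G f n : generated G f -> generated G (fun t => f t ^+ n).
Proof.
move=> Gf; elim: n => [|n IH]; first exact: gen_cst.
have -> : (fun t => f t ^+ n.+1) = (fun t => f t * f t ^+ n).
  by apply/funext => t; rewrite exprS.
exact: gen_mul.
Qed.

Lemma is_derive_scale (V : normedModType R) (f : R -> R) (v : V) (x df : R) :
  is_derive x 1 f df -> is_derive x 1 (fun t => f t *: v) (df *: v).
Proof.
move=> [fx fE]; have cv : h^-1 *: (f (h *: 1 + x) *: v - f x *: v)
    @[h --> 0^'] --> df *: v.
  rewrite -fE; have -> : (fun h : R => h^-1 *: (f (h *: 1 + x) *: v - f x *: v))
      = (fun h => (h^-1 *: (f (h *: 1 + x) - f x)) *: v).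
    by apply/funext => h; rewrite -scalerBl scalerA.
  exact: cvgZr_tmp.
by apply: DeriveDef; [apply/cvg_ex; exists (df *: v)|apply: cvg_lim].
Qed.

(** By the Leibniz rule it is enough to differentiate the generators. *)
Lemma generated_derive U G f : closed_under_derivation U G ->
  generated G f ->
  exists2 df, generated G df & forall x, U x -> is_derive x 1 f (df x).
Proof.
move=> UG; elim=> {f} [c|f /UG//|f g Gf [df Gdf fE] Gg [dg Gdg gE]
  |f g Gf [df Gdf fE] Gg [dg Gdg gE]].
- by exists (fun=> 0) => [|x _]; [exact: gen_cst|exact: is_derive_cst].
- exists (fun t => df t + dg t) => [|x Ux]; first exact: gen_add.
  by apply: is_deriveD; [exact: fE|exact: gE].
- exists (fun t => f t * dg t + g t * df t) => [|x Ux].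
    by apply: gen_add; exact: gen_mul.
  by apply: is_deriveM; [exact: fE|exact: gE].
Qed.

Lemma combination_derive (V : normedModType R) U G (F : R -> V) :
  closed_under_derivation U G -> combination G F ->
  exists2 dF, combination G dF & forall x, U x -> is_derive x 1 F (dF x).
Proof.
move=> UG; elim=> {F} [f v /(generated_derive UG)[df Gdf fE]
  |F1 F2 _ [d1 C1 E1] _ [d2 C2 E2]].
  exists (fun t => df t *: v) => [|x /fE]; first exact: comb_scale.
  exact: is_derive_scale.
exists (fun t => d1 t + d2 t) => [|x Ux]; first exact: comb_add.
by apply: is_deriveD; [exact: E1|exact: E2].
Qed.

(** By induction, each iterated derivative of [F] coincides on [U] with some
combination.  As [U] is open, this is an equality of germs at every point of
[U], hence the iterated derivative is itself differentiable there and its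
derivative is again a combination on [U].  The equality of [F] with a
combination is only required on [U] because junk values outside the natural
domain need not agree. *)
Lemma combination_smooth_on (V : normedModType R) U G (F F' : R -> V) :
  open U -> closed_under_derivation U G -> combination G F' ->
  (forall x, U x -> F x = F' x) -> smooth_on U F.
Proof.
move=> oU UG CF' FF' x Ux n.
have nearU y : U y -> \near y, U y by move=> Uy; exact: open_nbhs_nbhs.
suff [D CD FD] : exists2 D, combination G D &
    forall y, U y -> derive1n n F y = D y.
  have [dD _ DE] := combination_derive UG CD.
  apply: filterS (nearU x Ux) => y Uy.
  have [+ _] := DE y Uy; apply: near_eq_derivable.
  by apply: filterS (nearU y Uy) => z Uz; exact/esym/FD.
elim: n => [|n [D CD FD]]; first by exists F'.
have [dD CdD DE] := combination_derive UG CD.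
exists dD => // y Uy; rewrite derive1nS derive1E.
have [_ <-] := DE y Uy; apply: near_eq_derive.
by apply: filterS (nearU y Uy) => z Uz; exact: FD.
Qed.

Lemma generated_smooth_on U G (f f' : R -> R) :
  open U -> closed_under_derivation U G -> generated G f' ->
  (forall x, U x -> f x = f' x) -> smooth_on U f.
Proof.
move=> oU UG Gf' ff'.
apply: (@combination_smooth_on R U G f (fun t => f' t *: (1 : R^o))) => //.
  exact: comb_scale.
by move=> x Ux; rewrite ff'// -[RHS]/(f' x * 1) mulr1.
Qed.

Lemma smooth_onS (V : normedModType R) U U' (F : R -> V) :
  U `<=` U' -> smooth_on U' F -> smooth_on U F.
Proof. by move=> UU' F_smooth x /UU'; exact: F_smooth. Qed.

Lemma closed_under_derivationS U U' G : U `<=` U' ->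
  closed_under_derivation U' G -> closed_under_derivation U G.
Proof.
by move=> UU' U'G f /U'G[df Gdf E]; exists df => // x /UU'; exact: E.
Qed.

End Smoothness.

(** * The linear family of matrices and its frame angles *)

Section Pencil.
Context {R : realType}.
Implicit Types x y : R.

Definition pencil x y : 'M[R]_(3, 6) :=
  \matrix_(i < 3, j < 6)
    nth 0 (nth [::] [:: [:: x;  x;   0;  0;   y;  - y];
                        [:: 0;  0;   y;  - y; x;  x];
                        [:: y;  - y; x;  x;   0;  0]] i) j.

Lemma pencilE x y : pencil x y = x *: pencil 1 0 + y *: pencil 0 1.
Proof.
apply/matrixP => -[[|[|[|i]]] Hi]// -[[|[|[|[|[|[|j]]]]]] Hj]//;
  by rewrite !mxE /=; ring.
Qed.

Lemma pencil_rows x y (i i' : 'I_3) : x ^+ 2 + y ^+ 2 = 1 ->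
  dot (row i (pencil x y)) (row i' (pencil x y)) = (i == i')%:R * 2.
Proof.
move=> xy1; have -> : (2 : R) = 2 * (x ^+ 2 + y ^+ 2) by rewrite xy1 mulr1.
rewrite /dot !big_ord_recr big_ord0 /= !mxE.
by case: i => -[|[|[|i]]] Hi//; case: i' => -[|[|[|i']]] Hi'//=; ring.
Qed.

Lemma pencil_col_norm x y (j : 'I_6) :
  x ^+ 2 + y ^+ 2 = 1 -> enorm (fvec (pencil x y) j) = 1.
Proof.
move=> xy1; rewrite /enorm; have -> : dot (fvec (pencil x y) j)
    (fvec (pencil x y) j) = x ^+ 2 + y ^+ 2; last by rewrite xy1 sqrtr1.
rewrite /dot !big_ord_recr big_ord0 /= !mxE.
by case: j => -[|[|[|[|[|[|j]]]]]] Hj//=; ring.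
Qed.

(** The columns [2k] and [2k+1] form the k-th pair, whence the test on halves.
The zeros of two different pairs lie in different rows, so that two columns of
these pairs overlap in one row only, where up to sign the entry is [x] for one
of them and [y] for the other. *)
Lemma pencil_col_dot x y (j j' : 'I_6) : j != j' ->
  `|dot (fvec (pencil x y) j) (fvec (pencil x y) j')| =
  if j./2 == j'./2 then `|x ^+ 2 - y ^+ 2| else `|x * y|.
Proof.
rewrite /dot !big_ord_recr big_ord0 /= !mxE.
case: j => -[|[|[|[|[|[|j]]]]]] Hj//;
  case: j' => -[|[|[|[|[|[|j']]]]]] Hj'//= _;
  solve [congr `|_|; ring | rewrite -normrN; congr `|_|; ring].
Qed.

Lemma pencil_angles x y :
  frame_angles (pencil x y) = [set `|x ^+ 2 - y ^+ 2|; `|x * y|].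
Proof.
apply/seteqP; split=> [_ [j [j' [jj' ->]]]|_ [->|->]] /=.
- by rewrite pencil_col_dot//; case: ifP => _; [left|right].
- by exists (inord 0), (inord 1); rewrite -val_eqE
    pencil_col_dot -?val_eqE /= !inordK.
- by exists (inord 0), (inord 2); rewrite -val_eqE
    pencil_col_dot -?val_eqE /= !inordK.
Qed.

(** The rank is full because it is at least that of the invertible frame
operator. *)
Lemma pencil_real_frame x y :
  x ^+ 2 + y ^+ 2 = 1 -> real_frames R 6 3 (pencil x y).
Proof.
move=> xy1; have tight : pencil x y *m (pencil x y)^T = 2%:M.
  apply/matrixP => i i'; rewrite !mxE -[RHS]mulr_natl -(pencil_rows _ _ xy1).
  by apply: eq_bigr => k _; rewrite !mxE.
split; [by move=> j; exact: pencil_col_norm| |by exists 2].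
have rk : \rank (2%:M : 'M[R]_3) = 3.
  by rewrite -scalemx1 mxrank_scale_nz ?mxrank1.
apply/eqP; rewrite eqn_leq rank_leq_row -[X in (X <= _)%N]rk -tight.
exact: mxrankM_maxl.
Qed.

Lemma pencil_eq0 x y : pencil x y = 0 -> x = 0 /\ y = 0.
Proof.
by move=> /matrixP xy0; split; [have := xy0 0 0|have := xy0 2 0]; rewrite !mxE.
Qed.

End Pencil.

(** * The curve in coordinates on the unit circle *)

Section Curve.
Context {R : realType}.
Implicit Types t : R.

(** The slope of the point with coordinates [1 / t ^+ 2] and
[Num.sqrt ((t ^+ 4 - 1) / t ^+ 4)]. *)
Definition tan_arg t : R := Num.sqrt (t ^+ 4 - 1).

Lemma gt1_pow4 t : 1 < t -> 0 < t ^+ 4 - 1.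
Proof. by move=> t1; rewrite subr_gt0 exprn_egt1. Qed.

Lemma ge1_pow4 t : 1 <= t -> 0 <= t ^+ 4 - 1.
Proof. by move=> t1; rewrite subr_ge0 exprn_ege1. Qed.

Lemma sqrt_pow4 t : Num.sqrt (t ^+ 4) = t ^+ 2.
Proof. by rewrite (exprM t 2 2) sqrtr_sqr ger0_norm ?sqr_ge0. Qed.

Lemma curveE t : curve t = pencil (t ^- 2) (tan_arg t / t ^+ 2).
Proof.
rewrite /curve div1r mulrC sqrtrM ?invr_ge0 ?exprn_even_ge0//.
by rewrite sqrtrV ?exprn_even_ge0// sqrt_pow4 mulrC.
Qed.

Lemma circle_coords t : 1 <= t ->
  (t ^- 2) ^+ 2 + (tan_arg t / t ^+ 2) ^+ 2 = 1.
Proof.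
move=> t1; rewrite exprMn sqr_sqrtr ?ge1_pow4//.
have : t != 0 by rewrite gt_eqF// (lt_le_trans _ t1).
by move=> t0; field.
Qed.

Lemma signed_angle1E t : 1 <= t ->
  signed_angle1 t = (t ^- 2) ^+ 2 - (tan_arg t / t ^+ 2) ^+ 2.
Proof.
move=> t1; rewrite exprMn sqr_sqrtr ?ge1_pow4// /signed_angle1.
have : t != 0 by rewrite gt_eqF// (lt_le_trans _ t1).
by move=> t0; field.
Qed.

Lemma angle2E t : angle2 t = t ^- 2 * (tan_arg t / t ^+ 2).
Proof. by rewrite /angle2 mulrCA -invfM -exprD. Qed.

Lemma curve_angles t : 1 <= t -> frame_angles (curve t) = Theta t.
Proof.
move=> t1; rewrite curveE pencil_angles -signed_angle1E// -angle2E.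
by rewrite /Theta (ger0_norm (_ : 0 <= angle2 t))// divr_ge0// exprn_even_ge0.
Qed.

Lemma curve_real_frame t : 1 <= t -> real_frames R 6 3 (curve t).
Proof. by move=> t1; rewrite curveE; exact/pencil_real_frame/circle_coords. Qed.

(** * Continuity up to the endpoint *)

Lemma exp_cvg n t : x ^+ n @[x --> t] --> t ^+ n.
Proof. exact: exprn_continuous. Qed.

Lemma tan_arg_continuous : continuous tan_arg.
Proof.
move=> t; apply: (@cvg_comp _ _ _ (fun x : R => x ^+ 4 - 1));
  last exact: sqrt_continuous.
by apply: cvgB; [exact: exp_cvg|exact: cvg_cst].
Qed.

Lemma inv_exp_cvg n t : t != 0 -> x ^- n @[x --> t] --> t ^- n.
Proof. by move=> t0; apply: cvgV; [rewrite expf_neq0|exact: exp_cvg]. Qed.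

Lemma curve_continuous t : t != 0 -> {for t, continuous (@curve R)}.
Proof.
move=> t0; rewrite /prop_for /continuous_at.
have -> : @curve R =
    fun x => x ^- 2 *: pencil 1 0 + (tan_arg x / x ^+ 2) *: pencil 0 1.
  by apply/funext => x; rewrite curveE pencilE.
apply: cvgD; apply: cvgZr_tmp; first exact: inv_exp_cvg.
by apply: cvgM; [exact: tan_arg_continuous|exact: inv_exp_cvg].
Qed.

Lemma angle1_continuous t : t != 0 -> {for t, continuous (@angle1 R)}.
Proof.
move=> t0; apply: cvg_norm; apply: cvgM; last exact: inv_exp_cvg.
by apply: cvgB; [exact: cvg_cst|exact: exp_cvg].
Qed.

Lemma angle2_continuous t : t != 0 -> {for t, continuous (@angle2 R)}.
Proof.
by move=> t0; apply: cvgM; [exact: tan_arg_continuous|exact: inv_exp_cvg].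
Qed.

Lemma within_ge1_continuous (T : topologicalType) (f : R -> T) :
  (forall t, t != 0 -> {for t, continuous f}) ->
  {within `[1, +oo[, continuous f}.
Proof.
move=> cf; apply: continuous_in_subspaceT => t.
rewrite inE/= in_itv/= andbT => t1.
by apply: cf; rewrite gt_eqF// (lt_le_trans _ t1).
Qed.

(** * Smoothness in the original parameter *)

Lemma is_derive_inv t : t != 0 ->
  is_derive t 1 (GRing.inv : R -> R) (- t^-1 ^+ 2).
Proof.
move=> t0; apply: is_derive_eq; first exact: (is_deriveV (f := id)).
by rewrite -[LHS]/(- t ^- 2 * 1) mulr1 exprVn.
Qed.

Lemma is_derive_tan_argV t : 1 < t ->
  is_derive t 1 (fun t => (tan_arg t)^-1) (- (2 * t ^+ 3 * (tan_arg t)^-1 ^+ 3)).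
Proof.
move=> t1; have t41 := gt1_pow4 t1.
have r0 : tan_arg t != 0 by rewrite gt_eqF// sqrtr_gt0.
have dpow : is_derive t 1 (fun x : R => x ^+ 4 - 1) (4 * t ^+ 3).
  apply: (@is_derive_eq _ _ _ _ _ _ _ (4 * t ^+ 3 * 1 - 0)).
    have -> : (fun x : R => x ^+ 4 - 1) = id ^+ 4 - cst 1.
      by apply/funext => x; rewrite !fctE.
    by apply: is_deriveB; exact: (is_deriveX 4 (is_derive_id t 1)).
  by rewrite subr0 mulr1.
have dsqrt : is_derive t 1 tan_arg ((2 * tan_arg t)^-1 * (4 * t ^+ 3)).
  by apply: is_derive1_comp dpow; exact: is_derive1_sqrt.
apply: (is_derive_eq (is_deriveV r0 dsqrt)).
rewrite -[LHS]/(- tan_arg t ^- 2 * ((2 * tan_arg t)^-1 * (4 * t ^+ 3))).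
by field.
Qed.

Definition trig : set (R -> R) := [set sin; cos].
Definition recip : set (R -> R) := [set GRing.inv].
(** Taking the inverse of [tan_arg] as a generator makes its derivative
[- 2 t^3 tan_arg^-3] polynomial in the generators, and for [t > 1] the function
[tan_arg] itself is the product [(t ^+ 4 - 1) * (tan_arg t)^-1]. *)
Definition radical : set (R -> R) :=
  [set id; GRing.inv; fun t => (tan_arg t)^-1].

Lemma trig_closed : closed_under_derivation setT trig.
Proof.
move=> f [->|->].
  by exists cos; [apply: gen_base; right|move=> x _; exact: is_derive_sin].
exists (fun t => - sin t); last by move=> x _; exact: is_derive_cos.
by apply/gen_opp/gen_base; left.
Qed.

Lemma recip_closed : closed_under_derivation `]0, +oo[ recip.
Proof.
move=> f ->; exists (fun t => - t^-1 ^+ 2).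
  exact/gen_opp/gen_exp/gen_base.
move=> x/=; rewrite in_itv/= andbT => x0.
by apply: is_derive_inv; rewrite gt_eqF.
Qed.

Lemma radical_closed : closed_under_derivation `]1, +oo[ radical.
Proof.
have Gid : generated radical id by apply: gen_base; left; left.
have Ginv : generated radical GRing.inv by apply: gen_base; left; right.
have Grad : generated radical (fun t => (tan_arg t)^-1).
  by apply: gen_base; right.
move=> f [[->|->]|->].
- by exists (fun=> 1) => [|x _]; [exact: gen_cst|exact: is_derive_id].
- exists (fun t => - t^-1 ^+ 2); first exact/gen_opp/gen_exp.
  move=> x/=; rewrite in_itv/= andbT => x1; apply: is_derive_inv.
  by rewrite gt_eqF// (lt_trans _ x1).
- exists (fun t => - (2 * t ^+ 3 * (tan_arg t)^-1 ^+ 3)).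
    apply/gen_opp/gen_mul/gen_exp => //.
    by apply/gen_mul/gen_exp => //; exact: gen_cst.
  by move=> x/=; rewrite in_itv/= andbT; exact: is_derive_tan_argV.
Qed.

Lemma tan_arg_radical t : 1 < t ->
  tan_arg t / t ^+ 2 = (t ^+ 4 + -1) * ((tan_arg t)^-1 * t^-1 ^+ 2).
Proof.
move=> t1; have t41 := gt1_pow4 t1.
rewrite mulrA -{1}[t ^+ 4 + -1]sqr_sqrtr ?(ltW t41)// -/(tan_arg t).
by rewrite expr2 mulfK ?exprVn// gt_eqF// sqrtr_gt0.
Qed.

Lemma generated_tan_arg :
  generated radical (fun t => (t ^+ 4 + -1) * ((tan_arg t)^-1 * t^-1 ^+ 2)).
Proof.
apply: gen_mul; last apply: gen_mul.
- by apply: gen_add (gen_cst _ _); apply/gen_exp/gen_base; left; left.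
- by apply: gen_base; right.
- by apply/gen_exp/gen_base; left; right.
Qed.

Lemma generated_recip2 : generated radical (fun t => t^-1 ^+ 2).
Proof. by apply/gen_exp/gen_base; left; right. Qed.

Lemma curve_smooth : smooth_on `]1, +oo[ (@curve R).
Proof.
apply: (combination_smooth_on _ radical_closed
  (comb_add (comb_scale (pencil 1 0) generated_recip2)
            (comb_scale (pencil 0 1) generated_tan_arg))).
  exact: interval_open.
move=> x/=; rewrite in_itv/= andbT => x1.
by rewrite curveE pencilE tan_arg_radical// exprVn.
Qed.

Lemma angle2_smooth : smooth_on `]1, +oo[ (@angle2 R).
Proof.
apply: (generated_smooth_on _ radical_closed
  (gen_mul generated_recip2 generated_tan_arg)).
  exact: interval_open.
move=> x/=; rewrite in_itv/= andbT => x1.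
by rewrite angle2E tan_arg_radical// exprVn.
Qed.

Lemma generated_angle1 : generated recip (fun t => 2 * t^-1 ^+ 4 + -1).
Proof.
apply: gen_add (gen_cst _ _); apply: gen_mul; first exact: gen_cst.
by apply/gen_exp/gen_base.
Qed.

Lemma signed_angle1_recip t : 0 < t -> signed_angle1 t = 2 * t^-1 ^+ 4 + -1.
Proof. by move=> t0; rewrite /signed_angle1; field; rewrite gt_eqF. Qed.

Lemma signed_angle1_smooth : smooth_on `]0, +oo[ (@signed_angle1 R).
Proof.
apply: (generated_smooth_on _ recip_closed generated_angle1).
  exact: interval_open.
by move=> x/=; rewrite in_itv/= andbT; exact: signed_angle1_recip.
Qed.

Lemma open_pow4_lt : open [set t : R | t ^+ 4 < 2].
Proof.
apply: (@open_comp _ _ (fun t : R => t ^+ 4) [set x | x < 2]);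
  last exact: open_lt.
by move=> t _; exact: exp_cvg.
Qed.

Lemma open_pow4_gt : open [set t : R | 2 < t ^+ 4].
Proof.
apply: (@open_comp _ _ (fun t : R => t ^+ 4) [set x | 2 < x]);
  last exact: open_gt.
by move=> t _; exact: exp_cvg.
Qed.

(** Away from [t ^+ 4 = 2] the sign of the first angle is locally constant, so
its absolute value coincides with one of its two smooth signed versions. *)
Lemma angle1_smooth : smooth_on [set t : R | 1 <= t /\ t ^+ 4 != 2] (@angle1 R).
Proof.
move=> t [t1]; have t0 : 0 < t by exact: lt_le_trans t1.
rewrite neq_lt => /orP[t2|t2].
- apply: (generated_smooth_on (U := `]0, +oo[ `&` [set t | t ^+ 4 < 2])
    _ _ generated_angle1).
  + by apply: openI open_pow4_lt; exact: interval_open.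
  + by apply: closed_under_derivationS recip_closed; exact: subIsetl.
  + move=> x [/=]; rewrite in_itv/= andbT => x0 x2.
    rewrite /angle1 ger0_norm ?signed_angle1_recip// -signed_angle1_recip//.
    by rewrite divr_ge0 ?exprn_even_ge0// subr_ge0 ltW.
  + by split=> //=; rewrite in_itv/= t0.
- apply: (generated_smooth_on (U := `]0, +oo[ `&` [set t | 2 < t ^+ 4])
    _ _ (gen_opp generated_angle1)).
  + by apply: openI open_pow4_gt; exact: interval_open.
  + by apply: closed_under_derivationS recip_closed; exact: subIsetl.
  + move=> x [/=]; rewrite in_itv/= andbT => x0 x2.
    rewrite /angle1 ler0_norm ?signed_angle1_recip// -signed_angle1_recip//.
    by rewrite mulr_le0_ge0 ?invr_ge0 ?exprn_even_ge0// subr_le0 ltW.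
  + by split=> //=; rewrite in_itv/= t0.
Qed.

(** * Reparametrization by the angle on the circle *)

(** The argument of the point [(t ^- 2, tan_arg t / t ^+ 2)] of the unit circle;
its tangent is [tan_arg t]. *)
Definition curve_arg t := atan (tan_arg t).

Lemma cos_arg t : 1 <= t -> cos (curve_arg t) = t ^- 2.
Proof.
by move=> t1; rewrite cos_atan sqr_sqrtr ?ge1_pow4// addrC subrK sqrt_pow4.
Qed.

Lemma sin_arg t : 1 <= t -> sin (curve_arg t) = tan_arg t / t ^+ 2.
Proof.
move=> t1; rewrite -{1}[tan_arg t]atanK /tan -/(curve_arg t) -cos_arg// divfK//.
by rewrite cos_arg// invr_neq0// expf_neq0// gt_eqF// (lt_le_trans _ t1).
Qed.

Lemma arg_continuous : continuous curve_arg.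
Proof.
move=> t; apply: (@cvg_comp _ _ _ tan_arg); first exact: tan_arg_continuous.
exact: continuous_atan.
Qed.

Lemma arg_increasing s t : 1 <= s -> s < t -> curve_arg s < curve_arg t.
Proof.
move=> s1 st; apply: lt_atan; rewrite ltr_sqrt ?gt1_pow4 ?(le_lt_trans s1)//.
by rewrite ltrD2r ltrXn2r// (le_trans _ s1).
Qed.

Lemma trig_pencil_smooth : smooth_on setT (fun s : R => pencil (cos s) (sin s)).
Proof.
have Gsin : generated trig sin by apply: gen_base; left.
have Gcos : generated trig cos by apply: gen_base; right.
apply: (combination_smooth_on openT trig_closed
  (comb_add (comb_scale (pencil 1 0) Gcos) (comb_scale (pencil 0 1) Gsin))).
by move=> s _; rewrite pencilE.
Qed.

(** The velocity is the member of the linear family at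
[(- sin s, cos s)], a nonzero vector. *)
Lemma trig_pencil_regular (s : R) :
  derive1 (fun s : R => pencil (cos s) (sin s)) s != 0.
Proof.
have /@derive_val dE : is_derive s 1
    (fun s : R => cos s *: pencil 1 0 + sin s *: pencil 0 1 : 'M[R]_(3, 6))
    (pencil (- sin s) (cos s)).
  by rewrite [pencil (- _) _]pencilE; apply: is_deriveD; exact: is_derive_scale.
rewrite derive1E (_ : (fun _ => _) =
    (fun s : R => cos s *: pencil 1 0 + sin s *: pencil 0 1)).
  rewrite dE; apply/eqP => /pencil_eq0[/eqP]; rewrite oppr_eq0 => /eqP s0 c0.
  have := cos2Dsin2 s; rewrite s0 c0 expr0n addr0 => /esym/eqP.
  by rewrite oner_eq0.
by apply/funext => x; rewrite pencilE.
Qed.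

Lemma cosM_sin_smooth : smooth_on setT (fun s : R => cos s * sin s).
Proof.
apply: (generated_smooth_on openT trig_closed) => //.
by apply: gen_mul; apply: gen_base; [right|left].
Qed.

Lemma cos2B_sin2_smooth : smooth_on setT (fun s : R => cos s ^+ 2 - sin s ^+ 2).
Proof.
apply: (generated_smooth_on openT trig_closed) => //.
by apply: gen_add; [|apply: gen_opp]; apply/gen_exp/gen_base; [right|left].
Qed.

(** * The equiangular point *)

Definition etf_param : R := ((5 + Num.sqrt 5) / 2) `^ (4^-1).

Lemma etf_param_pow4 : etf_param ^+ 4 = (5 + Num.sqrt 5) / 2.
Proof.
rewrite -powR_mulrn ?powR_ge0// /etf_param -powRrM mulVf// powRr1//.
Qed.

Lemma etf_param_ge1 : 1 <= etf_param.
Proof.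
rewrite -(@ler_pXn2r _ 4)// ?nnegrE ?powR_ge0// expr1n etf_param_pow4.
by have := sqrtr_ge0 (5 : R); lra.
Qed.

(** With [s = Num.sqrt 5], both angles are [((1 + s) / 2) / ((s ^+ 2 + s) / 2)],
that is [1 / s]. *)
Lemma etf_param_Theta : Theta etf_param = [set 1 / Num.sqrt 5].
Proof.
rewrite /Theta /angle1 /angle2 /signed_angle1 etf_param_pow4.
have : 0 < Num.sqrt 5 :> R by rewrite sqrtr_gt0.
have : Num.sqrt 5 ^+ 2 = 5 :> R by rewrite sqr_sqrtr.
move: (Num.sqrt 5) => s s2 s0.
have -> : 2 - (5 + s) / 2 = - ((1 + s) / 2) by lra.
have -> : (5 + s) / 2 - 1 = ((1 + s) / 2) ^+ 2.
  by rewrite exprMn; lra.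
have s1_ge0 : 0 <= (1 + s) / 2 by rewrite divr_ge0 ?addr_ge0 ?ltW.
rewrite mulNr normrN sqrtr_sqr (ger0_norm s1_ge0) -[5]s2.
have -> : (1 + s) / 2 / ((s ^+ 2 + s) / 2) = 1 / s.
  by field; rewrite ?gt_eqF// addr_gt0// exprn_gt0.
by rewrite ger0_norm ?setUid// divr_ge0// ltW.
Qed.

End Curve.

(** * The theorem *)

Unset Implicit Arguments.
Set Strict Implicit.

Theorem mainTheorem4 (R : realType) :
  (* (i)-(iv) *)
  (forall t : R, 1 <= t ->
     [/\ forall i i' : 'I_3, i != i' ->
           dot (row i (curve t)) (row i' (curve t)) = 0,
         forall i : 'I_3, enorm (row i (curve t)) ^+ 2 = 2,
         forall j : 'I_6, enorm (fvec (curve t) j) = 1 &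
         frame_angles (curve t) = Theta t]) /\
  (* every point is a biangular tight frame *)
  (forall t : R, 1 <= t ->
     real_frames R 6 3 (curve t) /\ biangular (curve t)) /\
  (* smoothness in t of the curve and of the frame angles; the square roots
     are not differentiable at t = 1, and the absolute value is not
     differentiable at t ^+ 4 = 2 *)
  [/\ {within `[1, +oo[, continuous (@curve R)},
      smooth_on `]1, +oo[ (@curve R),
      {within `[1, +oo[, continuous (@angle1 R)} &
      {within `[1, +oo[, continuous (@angle2 R)}] /\
  [/\ smooth_on `[1, +oo[ (@signed_angle1 R),
      smooth_on [set t : R | 1 <= t /\ t ^+ 4 != 2] (@angle1 R) &
      smooth_on `]1, +oo[ (@angle2 R)] /\
  (* up to a reparametrization phi, the curve is smooth and regular also at its
     endpoint, with the frame angles depending smoothly on the parameter (up to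
     the absolute value in the first one) *)
  (exists (phi : R -> R) (g : R -> 'M[R]_(3, 6)) (alpha beta : R -> R),
     [/\ {within `[1, +oo[, continuous phi} &
         forall s t : R, 1 <= s -> s < t -> phi s < phi t] /\
     [/\ smooth_on setT g, forall s : R, derive1 g s != 0,
         smooth_on setT alpha & smooth_on setT beta] /\
     forall t : R, 1 <= t ->
       [/\ curve t = g (phi t), angle1 t = `|alpha (phi t)| &
           angle2 t = beta (phi t)]) /\
  (* the curve passes through an equiangular tight frame *)
  (let t0 : R := ((5 + Num.sqrt 5) / 2) `^ (4^-1) in
   [/\ 1 <= t0, Theta t0 = [set 1 / Num.sqrt 5],
       real_frames R 6 3 (curve t0) & equiangular (curve t0)]).
Proof.
have frames (t : R) : 1 <= t -> real_frames R 6 3 (curve t).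
  exact: curve_real_frame.
split=> [t t1|].
  split.
  - move=> i i' /negPf ii'.
    by rewrite curveE pencil_rows ?circle_coords// ii' mul0r.
  - move=> i.
    by rewrite sqr_sqrtr curveE pencil_rows ?circle_coords// eqxx mul1r.
  - by move=> j; have [] := frames t t1.
  - exact: curve_angles.
split=> [t t1|].
  split; first exact: frames.
  by exists (angle1 t), (angle2 t); exact: curve_angles.
split.
  split; [| exact: curve_smooth| |]; apply: within_ge1_continuous => t t0.
  - exact: curve_continuous.
  - exact: angle1_continuous.
  - exact: angle2_continuous.
split.
  split; [|exact: angle1_smooth|exact: angle2_smooth].
  apply: smooth_onS signed_angle1_smooth => t/=; rewrite !in_itv/= !andbT.
  exact: lt_le_trans.
split.
  exists curve_arg, (fun s : R => pencil (cos s) (sin s)),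
    (fun s : R => cos s ^+ 2 - sin s ^+ 2), (fun s : R => cos s * sin s).
  split; first split.
  - exact/continuous_subspaceT/arg_continuous.
  - exact: arg_increasing.
  split=> [|t t1]; first split.
  - exact: trig_pencil_smooth.
  - exact: trig_pencil_regular.
  - exact: cos2B_sin2_smooth.
  - exact: cosM_sin_smooth.
  by rewrite cos_arg// sin_arg// curveE /angle1 signed_angle1E// angle2E.
split.
- exact: etf_param_ge1.
- exact: etf_param_Theta.
- exact/frames/etf_param_ge1.
- exists (1 / Num.sqrt 5).
  by rewrite curve_angles ?etf_param_ge1// etf_param_Theta.
Qed.
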